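(* Let $X$ be a complex topological vector space and let $\Gamma\subset\mathcal{B}(X)$. Assume that for all $T,S\in\Gamma$ with $T\neq S$, there exists $A\in\Gamma$ such that $T=AS$. If $\Gamma$ is diskcyclic, then $\Gamma$ is disk transitive.
   Context: $\mathcal{B}(X)$ is the set of all continuous linear operators on $X$, and $\mathbb{D}=\{\alpha\in\mathbb{C}:|\alpha|\le 1\}$. $\Gamma$ is diskcyclic if there is $x\in X$ such that $\{\alpha Tx:\alpha\in\mathbb{D},\,T\in\Gamma\}$ is dense in $X$. $\Gamma$ is disk transitive if for any pair $(U,V)$ of nonempty open subsets of $X$ there exist $\alpha\in\mathbb{D}\setminus\{0\}$ and $T\in\Gamma$ such that $T(\alpha U)\cap V\neq\emptyset$. *)

(* Defs.v *)
From HB Require Import structures.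
From mathcomp Require Import all_boot all_order all_algebra.
From mathcomp Require Import complex.
From mathcomp Require Import classical_sets reals topology normedtype.

Set Implicit Arguments.
Unset Strict Implicit.
Unset Printing Implicit Defensive.

Import Order.TTheory GRing.Theory Num.Theory.

Local Open Scope classical_set_scope.
Local Open Scope ring_scope.

(* A complex topological vector space is a [topologicalLmodType R[i]] with
   [R : realType]: addition and scaling are jointly continuous. Neither local
   convexity (unlike [tvsType]) nor Hausdorff separation is required. *)

(* Operators are plain functions rather than bundled [{linear X -> X}], so that
   [T = A \o S] and [T <> S] are about the underlying maps. *)
Definition continuous_operators (R : realType) (X : topologicalLmodType R[i]) :
    set (X -> X) :=
  [set T | linear T /\ continuous T].
Arguments continuous_operators {R} X.

(* The disk is closed; `|a| lies in R[i], where [_ <= 1] restricted to norms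
   is the usual order of R. *)
Definition closed_unit_disk (R : realType) : set R[i] :=
  [set a | `|a| <= 1].

Definition diskcyclic (R : realType) (X : topologicalLmodType R[i])
    (Gamma : set (X -> X)) : Prop :=
  exists x : X,
    dense [set y | exists a : R[i], exists T : X -> X,
             [/\ closed_unit_disk a, Gamma T & y = a *: T x]].

Definition disk_transitive (R : realType) (X : topologicalLmodType R[i])
    (Gamma : set (X -> X)) : Prop :=
  forall U V : set X, open U -> U !=set0 -> open V -> V !=set0 ->
    exists a : R[i], exists T : X -> X,
      [/\ closed_unit_disk a, a != 0, Gamma T &
          (T @` [set a *: u | u in U]) `&` V !=set0].

(* Main.v *)
Require Import Defs.
From HB Require Import structures.
From mathcomp Require Import all_boot all_order all_algebra.
From mathcomp Require Import complex.
From mathcomp Require Import classical_sets reals topology normedtype.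
From mathcomp Require Import boolp.

Import Order.TTheory GRing.Theory Num.Theory.

Local Open Scope classical_set_scope.
Local Open Scope ring_scope.

(** Suppose [0 \notin V]; otherwise any [T] in [Gamma] and a small scalar do.
    Pick [z = a *: S x] in [U] with [a != 0]. Vectors [t *: z] with [t] small
    stay away from a neighbourhood [W] of a given point of [V]. Apply density of
    the disk orbit to [(e * a)^-1 W] rather than to [V], with [e] small: this
    yields [b] in the disk and [T] with [e * a * b *: T x] in [W]. The factor
    [a] makes [|e * b| <= 1] the coefficient relating this vector to [z], and the
    factor [e] forces [T <> S], so that [T = A \o S] sends [e * b *: z]
    into [V]. *)

(** Joint continuity of addition at [(v, 0)] and of scaling at [(0, z)]; the bound [e] depends on
    the direction [z]. *)
Lemma nbhs_addZ (K : numFieldType) (X : topologicalLmodType K) (V : set X)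
    (v z : X) :
  nbhs v V -> exists2 e : K, 0 < e &
    exists2 W : set X, nbhs v W &
      forall (t : K) (p : X), `|t| < e -> W p -> V (p + t *: z).
Proof.
move=> Vv.
have [[P Q] /= [Pv Q0] PQV] : nbhs (v, 0 : X) [set q : X * X | V (q.1 + q.2)].
  by apply: (add_continuous (v, 0 : X)); rewrite /= addr0.
have [[C D] /= [C0 Dz] CDQ] :
    nbhs (0 : K^o, z) [set q : K^o * X | Q (q.1 *: q.2)].
  by apply: (scale_continuous (0 : K^o, z)); rewrite /= scale0r.
have [e /= e0 eC] := C0.
exists e => //; exists P => // t p te Pp.
apply: (PQV (p, t *: z)); split => //=.
apply: (CDQ (t, z)); split => /=; last exact: nbhs_singleton.
by apply: eC; rewrite /= sub0r normrN.
Qed.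

Lemma open_preimageZ (K : numFieldType) (X : topologicalLmodType K) (k : K)
    (V : set X) :
  open V -> open [set y | V (k *: y)].
Proof.
rewrite !openE => oV y Vky.
have [[C D] /= [Ck Dy] CDV] : nbhs (k : K^o, y) [set q : K^o * X | V (q.1 *: q.2)].
  by apply: (scale_continuous (k : K^o, y)); exact: oV.
apply: filterS Dy => w Dw; apply: (CDV (k, w)); split => //=.
exact: (nbhs_singleton Ck).
Qed.

Lemma open0_small_scalar (K : numFieldType) (X : topologicalLmodType K)
    (V : set X) (z : X) :
  open V -> V 0 -> exists c : K, [/\ c != 0, `|c| <= 1 & V (c *: z)].
Proof.
move=> oV V0.
have [e e0 [W W0 WV]] := nbhs_addZ _ _ V 0 z (open_nbhs_nbhs (conj oV V0)).
(* The scalar [e / (1 + e)] lies strictly below both [e] and [1], with no need to compare these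
   two. *)
have c0 : 0 < e / (1 + e) by rewrite divr_gt0 ?addr_gt0.
have e1 : 0 < 1 + e by rewrite addr_gt0.
exists (e / (1 + e)); split; first by rewrite gt_eqF.
  by rewrite gtr0_norm// ler_pdivrMr// mul1r lerDr.
rewrite -[_ *: z]add0r; apply: WV; last exact: nbhs_singleton.
by rewrite gtr0_norm// ltr_pdivrMr// mulrDr mulr1 ltrDl mulr_gt0.
Qed.

Theorem theorem3p7 (R : realType) (X : topologicalLmodType R[i])
    (Gamma : set (X -> X))
    (Gamma_sub : Gamma `<=` continuous_operators X)
    (Gamma_quot : forall T S : X -> X, Gamma T -> Gamma S -> T <> S ->
       exists A : X -> X, Gamma A /\ T = A \o S)
    (Gamma_cyclic : diskcyclic Gamma) :
  disk_transitive Gamma.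
Proof.
move=> U V oU [u Uu] oV [v Vv].
have GammaZ T c y : Gamma T -> T (c *: y) = c *: T y.
  move=> /Gamma_sub [linT _].
  have T0 : T 0 = 0.
    by have := linT (-1) 0 0; rewrite scaler0 addr0 scaleN1r addNr.
  by have := linT c y 0; rewrite !addr0 T0 addr0.
suff [a [T [y [a1 a0 GT Uy VTy]]]] : exists a T y,
    [/\ `|a| <= 1, a != 0, Gamma T, U y & V (a *: T y)].
  exists a, T; split=> //; exists (a *: T y); split=> //.
  by exists (a *: y); [exists y | exact: GammaZ].
have [x xdense] := Gamma_cyclic.
have [a [S [GS a0 Uz]]] : exists a S, [/\ Gamma S, a != 0 & U (a *: S x)].
  have [y [Uy [a [S [_ GS yE]]]]] := xdense U (ex_intro _ u Uu) oU.
  rewrite {}yE in Uy.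
  (* A zero coefficient forces [0] into [U], which then also contains a small nonzero multiple of
     [S x]. *)
  have [a0|a0] := eqVneq a 0; last by exists a, S.
  rewrite a0 scale0r in Uy.
  by have [c [c0 _ Uc]] := open0_small_scalar _ _ U (S x) oU Uy; exists c, S.
have [V0|V0] := pselect (V 0).
  have [c [c0 c1 Vc]] := open0_small_scalar _ _ V (S (a *: S x)) oV V0.
  by exists c, S, (a *: S x).
have [d d0 [W Wv WV]] :=
  nbhs_addZ _ _ V v (a *: S x) (open_nbhs_nbhs (conj oV Vv)).
have d1 : 0 < 1 + d by rewrite addr_gt0.
(* Here [e < d] serves to separate [T] from [S], and [e <= 1] keeps [e * b] in the disk. *)
pose e := d / (1 + d).
have e0 : 0 < e by rewrite divr_gt0.
have ea0 : e * a != 0 by rewrite mulf_neq0// gt_eqF.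
have [y [Wy [b [T [b1 GT yE]]]]] : (
    [set y | (W^°)%classic (e * a *: y)] `&` [set y | exists b T,
      [/\ closed_unit_disk b, Gamma T & y = b *: T x]]) !=set0.
  apply: xdense; last exact/open_preimageZ/open_interior.
  exists ((e * a)^-1 *: v) => /=.
  by rewrite scalerA divff// scale1r.
rewrite {}yE /= in Wy; move/interior_subset : Wy => Wy.
(* Subtracting [t *: (a *: S x)] from itself would put [0] in [V]. *)
have WnV t : `|t| < d -> W (t *: (a *: S x)) -> False.
  move=> td /(WV (- t)); rewrite normrN scaleNr subrr => /(_ td).
  exact: V0.
have ebe : `|e * b| <= e by rewrite normrM gtr0_norm// ler_piMr// ltW.
have ed : e < d by rewrite ltr_pdivrMr// mulrDr mulr1 ltrDl mulr_gt0.
have e1 : e <= 1 by rewrite ler_pdivrMr// mul1r lerDr.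
have eabE w : (e * a) *: (b *: w) = (e * b) *: (a *: w).
  by rewrite !scalerA mulrAC.
rewrite eabE in Wy.
(* If [T = S], the point found in [W] is a multiple of [a *: S x] by a scalar of norm below [d]. *)
have TS : T <> S.
  by move=> TS; apply: (WnV (e * b)); [exact: le_lt_trans ed | rewrite -TS].
have [A [GA TA]] := Gamma_quot T S GT GS TS.
exists (e * b), A, (a *: S x); split => //.
- exact: le_trans e1.
- apply/eqP => eb0; apply: (WnV 0); first by rewrite normr0.
  by move: Wy; rewrite eb0 !scale0r.
(* Since [A (S x) = T x], the image is the point of [W] already found; [t = 0] in [WV] gives the
   inclusion of [W] in [V]. *)
- rewrite GammaZ// -[A (S x)]/((A \o S) x) -TA.
  have := WV 0 _ _ Wy; rewrite normr0 scale0r addr0; exact.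
Qed.
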